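(* Let $M\in\mathbb{R}^{n\times n}$ be a positive semidefinite matrix, let $q_0,q_1,\dots,q_L\in\mathbb{R}^n$, and let $\mathcal{U}\subset\mathbb{R}^L$ be one of $\mathcal{U}_1=\{u:\|u\|_1\le 1\}$, $\mathcal{U}_2=\{u:\|u\|_2\le 1\}$, $\mathcal{U}_\infty=\{u:\|u\|_\infty\le 1\}$. Consider the robust counterpart of the uncertain linear complementarity problem with deterministic matrix $M$ and uncertain vector $q(u)=q_0+\sum_{l=1}^L u_l q_l$, $u\in\mathcal{U}$: $$\begin{array}{rl}\displaystyle\min_{x\in\mathbb{R}^n} & x^T(Mx+q_0)+\displaystyle\max_{u\in\mathcal{U}}\sum_{l=1}^L u_l\,(x^Tq_l)\\ \text{subject to} & M_{i\bullet}x+[q_0]_i+\displaystyle\min_{u\in\mathcal{U}}\sum_{l=1}^L u_l[q_l]_i\ \ge 0,\quad i=1,\dots,n,\\ & x\ge 0.\end{array}$$ Then this problem can be reformulated as a tractable program.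
   Context: $M_{i\bullet}$ denotes the $i$-th row of $M$, $[v]_i$ the $i$-th entry of a vector $v$; vector inequalities are componentwise. Positive semidefinite means $x^TMx\ge 0$ for all $x\in\mathbb{R}^n$ ($M$ is not required to be symmetric). A tractable program is a single finite-dimensional convex optimization problem: finitely many real decision variables, a linear or convex quadratic objective to be minimized, and finitely many constraints, each of which is an affine (in)equality, a convex quadratic inequality, a second-order cone constraint, or a linear matrix inequality (no constraint or objective term is indexed by, or optimized over, $u\in\mathcal{U}$). A minimization problem (P) in $x$ is reformulated as a problem (Q) in variables $(x,w)$, with $w$ a finite vector of additional variables, if for every $x$ and every $t\in\mathbb{R}$: $x$ is feasible for (P) with objective value at most $t$ if and only if there is $w$ such that $(x,w)$ is feasible for (Q) with objective value at most $t$ (here $t$ itself may be used as one of the variables of (Q)). *)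

(* Defs.v *)
From Stdlib Require List.
From HB Require Import structures.
From mathcomp Require Import all_boot all_order all_algebra.
From mathcomp Require Import boolp classical_sets reals convex.

Set Implicit Arguments.
Unset Strict Implicit.
Unset Printing Implicit Defensive.

Import Order.TTheory GRing.Theory Num.Theory.

Local Open Scope classical_set_scope.
Local Open Scope ring_scope.

Section Vectors.
Variable R : realType.

Definition dot (n : nat) (x y : 'cV[R]_n) : R := (x^T *m y) 0 0.

Definition norm1 (n : nat) (x : 'cV[R]_n) : R := \sum_i `|x i 0|.

Definition norm2 (n : nat) (x : 'cV[R]_n) : R :=
  Num.sqrt (\sum_i x i 0 ^+ 2).

Definition normoo (n : nat) (x : 'cV[R]_n) : R :=
  \big[Num.max/0]_i `|x i 0|.

(* Symmetry is deliberately not required. *)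
Definition psd (n : nat) (M : 'M[R]_n) : Prop :=
  forall x : 'cV[R]_n, 0 <= dot x (M *m x).

End Vectors.

Section Programs.
Variable R : realType.

(* Minimization of [objective] over the points satisfying [feasible]. *)
Record problem (n : nat) := Problem {
  feasible : 'cV[R]_n -> Prop;
  objective : 'cV[R]_n -> R
}.

Definition reformulates (n m : nat) (P : problem n) (Q : problem (n + m)) :
    Prop :=
  forall (x : 'cV[R]_n) (t : R),
    feasible P x /\ objective P x <= t <->
    exists w : 'cV[R]_m,
      feasible Q (col_mx x w) /\ objective Q (col_mx x w) <= t.

Definition quad_eval (N : nat) (A : 'M[R]_N) (b : 'cV[R]_N) (c : R)
    (z : 'cV[R]_N) : R :=
  dot z (A *m z) + dot b z + c.

(* The linear functions are those with zero matrix. *)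
Record convex_quadratic (N : nat) := ConvexQuadratic {
  quad_mx : 'M[R]_N;
  quad_lin : 'cV[R]_N;
  quad_cst : R;
  quad_convex :
    convex_function (setT : set (convex_lmodType 'cV[R]_N))
      (quad_eval quad_mx quad_lin quad_cst)
}.

Definition quad_fun (N : nat) (f : convex_quadratic N) : 'cV[R]_N -> R :=
  quad_eval (quad_mx f) (quad_lin f) (quad_cst f).

Inductive constraint (N : nat) :=
| AffineIneq (a : 'cV[R]_N) (b : R)
| AffineEq (a : 'cV[R]_N) (b : R)
| QuadIneq (f : convex_quadratic N)
| SecondOrderCone (k : nat) (A : 'M[R]_(k, N)) (b : 'cV[R]_k)
    (c : 'cV[R]_N) (d : R)
| LinearMatrixIneq (k : nat) (F0 : 'M[R]_k) (F : 'I_N -> 'M[R]_k)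
    (F0_sym : F0^T = F0) (F_sym : forall j, (F j)^T = F j).

Definition satisfies (N : nat) (z : 'cV[R]_N) (C : constraint N) : Prop :=
  match C with
  | AffineIneq a b => dot a z + b <= 0
  | AffineEq a b => dot a z + b = 0
  | QuadIneq f => quad_fun f z <= 0
  | SecondOrderCone _ A b c d => norm2 (A *m z + b) <= dot c z + d
  | LinearMatrixIneq _ F0 F _ _ => psd (F0 + \sum_j z j 0 *: F j)
  end.

Record tractable_program (N : nat) := TractableProgram {
  tp_objective : convex_quadratic N;
  tp_constraints : seq (constraint N)
}.

Definition problem_of_tractable (N : nat) (Q : tractable_program N) :
    problem N :=
  Problem
    (fun z => List.Forall (satisfies z) (tp_constraints Q))
    (quad_fun (tp_objective Q)).

Definition tractable_reformulation (n : nat) (P : problem n) : Prop :=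
  exists (m : nat) (Q : tractable_program (n + m)),
    reformulates P (problem_of_tractable Q).

End Programs.

Section RobustLCP.
Variable R : realType.

Definition ball1 (L : nat) : set 'cV[R]_L := [set u | norm1 u <= 1].
Definition ball2 (L : nat) : set 'cV[R]_L := [set u | norm2 u <= 1].
Definition balloo (L : nat) : set 'cV[R]_L := [set u | normoo u <= 1].

(* [sup] and [inf] below are a maximum and a minimum for U one of the balls
   above: a linear function is optimized over a nonempty compact set. *)
Definition robust_lcp (n L : nat) (M : 'M[R]_n) (q0 : 'cV[R]_n)
    (q : 'I_L -> 'cV[R]_n) (U : set 'cV[R]_L) : problem R n :=
  Problem
    (fun x : 'cV[R]_n =>
       (forall i : 'I_n,
          0 <= (row i M *m x) 0 0 + q0 i 0
               + inf [set \sum_(l < L) u l 0 * q l i 0 | u in U]) /\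
       (forall i : 'I_n, 0 <= x i 0))
    (fun x : 'cV[R]_n =>
       dot x (M *m x + q0)
       + sup [set \sum_(l < L) u l 0 * dot x (q l) | u in U]).

End RobustLCP.

(* Main.v *)
Require Import Defs.
From Stdlib Require List.
From mathcomp Require Import all_boot all_order all_algebra.
From mathcomp Require Import boolp classical_sets reals.
From mathcomp Require Import interval_inference convex ring lra.

(** The inner minimum in the [i]-th constraint does not depend on [x], so that
    constraint is affine.  In the objective, the inner maximum is the dual norm
    of the vector [c] with entries [c_l = x^T q_l]: the l_oo, l_2 or l_1 norm
    of [c] for the l_1, l_2 or l_oo ball.  The epigraph of this dual norm is
    described by affine inequalities (l_oo with one extra variable, l_1 with one
    variable per coordinate) or by one second-order cone (l_2), and the extra
    variables enter the objective through their sum, which leaves it convex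
    quadratic since [M] is positive semidefinite. *)

Import Order.TTheory GRing.Theory Num.Theory.

Local Open Scope ring_scope.

(** * Bilinearity of the dot product *)

Section DotProduct.
Variable R : realType.

Lemma dotE n (x y : 'cV[R]_n) : dot x y = \sum_i x i 0 * y i 0.
Proof. by rewrite /dot mxE; apply: eq_bigr => i _; rewrite mxE. Qed.

Lemma dotC n (x y : 'cV[R]_n) : dot x y = dot y x.
Proof. by rewrite !dotE; apply: eq_bigr => i _; rewrite mulrC. Qed.

Lemma dotDl n (x y z : 'cV[R]_n) : dot (x + y) z = dot x z + dot y z.
Proof. by rewrite /dot linearD mulmxDl mxE. Qed.

Lemma dotZl n a (x y : 'cV[R]_n) : dot (a *: x) y = a * dot x y.
Proof. by rewrite /dot linearZ -scalemxAl mxE. Qed.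

Lemma dotDr n (x y z : 'cV[R]_n) : dot x (y + z) = dot x y + dot x z.
Proof. by rewrite /dot mulmxDr mxE. Qed.

Lemma dotZr n a (x y : 'cV[R]_n) : dot x (a *: y) = a * dot x y.
Proof. by rewrite /dot -scalemxAr mxE. Qed.

Lemma dotNl n (x y : 'cV[R]_n) : dot (- x) y = - dot x y.
Proof. by rewrite -scaleN1r dotZl mulN1r. Qed.

Lemma dot0l n (x : 'cV[R]_n) : dot 0 x = 0.
Proof. by rewrite /dot trmx0 mul0mx mxE. Qed.

Lemma dot_col_mx n m (x y : 'cV[R]_n) (w v : 'cV[R]_m) :
  dot (col_mx x w) (col_mx y v) = dot x y + dot w v.
Proof. by rewrite /dot tr_col_mx mul_row_col mxE. Qed.

Lemma dot_delta n i (x : 'cV[R]_n) : dot (delta_mx i 0) x = x i 0.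
Proof. by rewrite /dot trmx_delta -rowE mxE. Qed.

End DotProduct.

(** * Convexity of positive semidefinite quadratic functions *)

Section Convexity.
Variable R : realType.

(* With [s = 1 - t], the convexity gap is
   [t f(x) + s f(y) - f(t x + s y) = t s (x - y)^T A (x - y)]. *)
Lemma psd_quad_convex N (A : 'M[R]_N) b c : psd A ->
  convex_function (setT : set (convex_lmodType 'cV[R]_N)) (quad_eval A b c).
Proof.
move=> psdA t x y _ _.
have t0 : 0 <= t%:inum :> R by [].
have t1 : t%:inum <= 1 :> R by [].
rewrite convRE; set r := t%:inum in t0 t1 *.
rewrite [conv t x y](_ : _ = r *: (x : 'cV_N) + (1 - r) *: (y : 'cV_N)) //.
rewrite /unstable.onem /quad_eval.
(* The difference is written with [(-1) *: y] so that the rules for sums and scalings alone expand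
   it. *)
have := psdA ((x : 'cV_N) + (-1) *: (y : 'cV_N)).
rewrite !(mulmxDr, dotDl, dotDr, =^~ scalemxAr, dotZl, dotZr).
move=> gap0.
have rr : 0 <= r * (1 - r) by rewrite mulr_ge0 // subr_ge0.
have := mulr_ge0 rr gap0; rewrite -subr_ge0 => gap.
rewrite -subr_ge0; apply: (le_trans gap).
by rewrite le_eqVlt; apply/orP; left; apply/eqP; ring.
Qed.

End Convexity.

(** * Finite lists of constraints *)

Section ConstraintLists.
Variables (R : realType) (N : nat).
Implicit Type z : 'cV[R]_N.

Lemma Forall_cat (T : Type) (P : T -> Prop) (s1 s2 : seq T) :
  List.Forall P (s1 ++ s2) <-> List.Forall P s1 /\ List.Forall P s2.
Proof. exact: List.Forall_app. Qed.

Lemma Forall_codom (T : Type) (P : T -> Prop) (k : nat) (f : 'I_k -> T) :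
  List.Forall P (codom f) <-> forall i, P (f i).
Proof.
rewrite /codom /image_mem.
split=> [Pf i|Pf]; last by elim: (enum _) => [|i s IHs]; constructor.
have: i \in enum 'I_k by rewrite mem_enum.
elim: (enum _) Pf => [|j s IHs] //= Pf.
by inversion Pf; rewrite inE => /orP[/eqP ->|/IHs]; auto.
Qed.

(** Splits each absolute value into two affine inequalities; both polyhedral epigraphs, of the l_oo
    and of the l_1 norm, are encoded this way. *)
Lemma Forall_abs_le (k : nat) (a b : 'I_k -> 'cV[R]_N) z :
  List.Forall (satisfies z)
    (codom (fun l => AffineIneq (a l - b l) 0)
     ++ codom (fun l => AffineIneq (- a l - b l) 0))
  <-> forall l, `|dot (a l) z| <= dot (b l) z.
Proof.
rewrite Forall_cat !Forall_codom /=; split=> [[h1 h2] l|h].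
  move: (h1 l) (h2 l); rewrite !(dotDl, dotNl) ler_norml => ? ?.
  by apply/andP; split; lra.
by split=> l; move: (h l); rewrite !(dotDl, dotNl) ler_norml => /andP[] ? ?;
  lra.
Qed.

End ConstraintLists.

(** * Support functions of the three unit balls *)

Section DualNorms.
Local Open Scope classical_set_scope.
Variables (R : realType) (L : nat).
Implicit Types u c : 'cV[R]_L.

Lemma sup_attained (A : set R) (a : R) : A a -> ubound A a -> sup A = a.
Proof.
move=> Aa ubA; apply/le_anti/andP; split; first by apply: ge_sup => //; exists a.
by apply: ub_le_sup => //; exists a.
Qed.

Lemma ler_sum_mul_norm u c : \sum_l u l 0 * c l 0 <= \sum_l `|u l 0| * `|c l 0|.
Proof. by apply: ler_sum => l _; rewrite -normrM ler_norm. Qed.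

Lemma le_normoo c l : `|c l 0| <= normoo c.
Proof. exact: (le_bigmax _ (fun l => `|c l 0|)). Qed.

(** The maximum starts from 0, so [0 <= t] is a separate condition: for [L = 0] it is the only
    one. *)
Lemma normoo_leP c (t : R) :
  reflect (0 <= t /\ forall l, `|c l 0| <= t) (normoo c <= t).
Proof.
by apply: (iffP (bigmax_leP _ _ _ _)) => -[t0 ct]; split => // l *; apply: ct.
Qed.

Lemma normoo_ge0 c : 0 <= normoo c.
Proof. by have /normoo_leP[] := lexx (normoo c). Qed.

Lemma normoo_attained c : normoo c = 0 \/ exists l, normoo c = `|c l 0|.
Proof.
rewrite /normoo; elim/big_ind: _ => [|x y hx hy|l _]; first by left.
  by rewrite /Num.max /Order.max; case: ifP.
by right; exists l.
Qed.

(** Hoelder's inequality gives the upper bound. It is attained at the basis vector of an entry of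
    largest absolute value, scaled by the sign of that entry, or at 0 when [normoo c = 0]. *)
Lemma sup_ball1 c :
  sup [set \sum_l u l 0 * c l 0 | u in @ball1 R L] = normoo c.
Proof.
apply: sup_attained.
  case: (normoo_attained c) => [->|[k ->]].
    exists 0; last by rewrite big1 // => l _; rewrite mxE mul0r.
    by rewrite /ball1/= /norm1 big1 // => l _; rewrite mxE normr0.
  exists (Num.sg (c k 0) *: delta_mx k 0).
    rewrite /ball1/= /norm1 (bigD1 k) //= big1 ?addr0.
      by rewrite !mxE !eqxx mulr1 normr_sg lern1 leq_b1.
    by move=> l /negbTE lk; rewrite !mxE lk mulr0 normr0.
  rewrite (bigD1 k) //= big1 ?addr0; last first.
    by move=> l /negbTE lk; rewrite !mxE lk mulr0 mul0r.
  by rewrite !mxE !eqxx mulr1 -normrEsg.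
move=> _ [u + <-]; rewrite /ball1/= /norm1 => u1.
apply: (le_trans (ler_sum_mul_norm u c)).
apply: (@le_trans _ _ (\sum_l `|u l 0| * normoo c)).
  by apply: ler_sum => l _; rewrite ler_wpM2l // le_normoo.
by rewrite -mulr_suml ler_piMl // normoo_ge0.
Qed.

(** The vector of signs of [c] is a maximizer, and the bound holds coordinate by coordinate. *)
Lemma sup_balloo c :
  sup [set \sum_l u l 0 * c l 0 | u in @balloo R L] = norm1 c.
Proof.
apply: sup_attained.
  exists (\col_l Num.sg (c l 0)).
    rewrite /balloo/=; apply/normoo_leP; split=> // l.
    by rewrite mxE normr_sg lern1 leq_b1.
  by apply: eq_bigr => l _; rewrite mxE -normrEsg.
move=> _ [u /normoo_leP[_ u1] <-].
apply: (le_trans (ler_sum_mul_norm u c)).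
by apply: ler_sum => l _; rewrite ler_piMl.
Qed.

Lemma norm2_sqr c : norm2 c ^+ 2 = \sum_l c l 0 ^+ 2.
Proof. by rewrite /norm2 sqr_sqrtr // sumr_ge0 // => l _; rewrite sqr_ge0. Qed.

(** This is Cauchy-Schwarz, with equality at [c] divided by its norm; the case of norm 0, where
    every value is 0, is treated first. *)
Lemma sup_ball2 c :
  sup [set \sum_l u l 0 * c l 0 | u in @ball2 R L] = norm2 c.
Proof.
have [c0|c0] := eqVneq (norm2 c) 0.
  have cl0 l : c l 0 = 0.
    have := norm2_sqr c; rewrite c0 expr0n/= => /esym/eqP.
    rewrite psumr_eq0; last by move=> k _; rewrite sqr_ge0.
    by move=> /allP/(_ l (mem_index_enum l)); rewrite sqrf_eq0 => /eqP.
  have val0 u : \sum_l u l 0 * c l 0 = 0.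
    by rewrite big1 // => l _; rewrite cl0 mulr0.
  rewrite c0; apply: sup_attained => [|_ [u _ <-]]; last by rewrite val0.
  exists 0 => //; rewrite /ball2/= /norm2 big1 ?sqrtr0 // => l _.
  by rewrite mxE expr0n.
have cgt0 : 0 < norm2 c by rewrite lt_def c0 sqrtr_ge0.
apply: sup_attained.
  exists ((norm2 c)^-1 *: c).
    rewrite /ball2/= {1}/norm2.
    under eq_bigr do rewrite mxE exprMn.
    by rewrite -mulr_sumr -norm2_sqr -exprMn mulVf // expr1n sqrtr1.
  under eq_bigr do rewrite mxE -mulrA -expr2.
  by rewrite -mulr_sumr -norm2_sqr expr2 mulKf.
move=> _ [u + <-]; rewrite /ball2/= => u1.
have u2 : \sum_l u l 0 ^+ 2 <= 1.
  by rewrite -norm2_sqr expr_le1 // sqrtr_ge0.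
set r := norm2 c in cgt0 c0 *.
(* AM-GM: [u c <= (r u^2 + c^2 / r) / 2] *)
apply: (@le_trans _ _ (\sum_l (r * u l 0 ^+ 2 + r^-1 * c l 0 ^+ 2) / 2)).
  apply: ler_sum => l _; rewrite -subr_ge0.
  have -> : (r * u l 0 ^+ 2 + r^-1 * c l 0 ^+ 2) / 2 - u l 0 * c l 0
    = r^-1 / 2 * (r * u l 0 - c l 0) ^+ 2 by field.
  by rewrite mulr_ge0 ?sqr_ge0 // mulr_ge0 // invr_ge0 // ltW.
(* The entries of [c] contribute [r^-1 * r^2 = r], so the bound becomes
   [(r * \sum_l u_l^2 + r) / 2], which is at most [r] by [u2]. *)
rewrite -mulr_suml big_split /= -!mulr_sumr -(norm2_sqr c) -/r (expr2 r) mulKf //.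
have := ler_wpM2l (ltW cgt0) u2; lra.
Qed.

End DualNorms.

(** * Construction of the tractable programs *)

Section Reformulation.
Local Open Scope classical_set_scope.
Variables (R : realType) (n L : nat) (M : 'M[R]_n) (q0 : 'cV[R]_n)
  (q : 'I_L -> 'cV[R]_n).

(** Isolates what depends on the ball: [cs] has to describe the epigraph of the inner maximum.
    Bounding the sum of [w] covers both a single extra variable and one per coordinate. *)
Lemma robust_lcp_reformulation (m : nat) (U : set 'cV[R]_L)
    (cs : seq (constraint R (n + m))) :
  psd M ->
  (forall (x : 'cV[R]_n) (s : R),
    sup [set \sum_(l < L) u l 0 * dot x (q l) | u in U] <= s <->
    exists w : 'cV[R]_m,
      List.Forall (satisfies (col_mx x w)) cs /\ \sum_j w j 0 <= s) ->
  tractable_reformulation (robust_lcp M q0 q U).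
Proof.
move=> psdM csP.
(* At [(x, w)] this quadratic form is [x^T M x]; the ones in the linear part of [obj] below add the
   sum of [w]. *)
have psdA : psd (block_mx M 0 0 (0 : 'M_m)).
  move=> z; rewrite -[z]vsubmxK mul_block_col !mul0mx !addr0 dot_col_mx.
  by rewrite [dot _ 0]dotC dot0l addr0; apply: psdM.
pose k i := inf [set \sum_(l < L) u l 0 * q l i 0 | u in U].
pose obj := ConvexQuadratic (@psd_quad_convex R _ _
  (col_mx q0 (const_mx 1)) 0 psdA).
(* [AffineIneq] asks for a nonpositive value, so both families of constraints are negated. *)
pose base : seq (constraint R (n + m)) :=
  codom (fun i => AffineIneq (col_mx (- (row i M)^T) 0) (- (q0 i 0 + k i)))
  ++ codom (fun i => AffineIneq (col_mx (- delta_mx i 0) 0) 0).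
exists m, (TractableProgram obj (base ++ cs)) => x t /=.
have objE (w : 'cV[R]_m) : quad_fun obj (col_mx x w)
    = dot x (M *m x + q0) + \sum_j w j 0.
  rewrite /quad_fun /quad_eval/= mul_block_col !mul0mx !addr0 !dot_col_mx.
  rewrite [dot w 0]dotC dot0l addr0 dotDr [dot q0 x]dotC -addrA.
  congr (_ + (_ + _)); rewrite dotE.
  by apply: eq_bigr => j _; rewrite mxE mul1r.
have baseE (w : 'cV[R]_m) : List.Forall (satisfies (col_mx x w)) base <->
    feasible (robust_lcp M q0 q U) x.
  have rowE i : dot (col_mx (- (row i M)^T) 0) (col_mx x w)
      = - (row i M *m x) 0 0.
    by rewrite dot_col_mx dot0l addr0 dotNl /dot trmxK.
  have deltaE i : dot (col_mx (- delta_mx i 0) 0) (col_mx x w) = - x i 0.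
    by rewrite dot_col_mx dot0l addr0 dotNl dot_delta.
  rewrite Forall_cat !Forall_codom/=; split=> -[h1 h2]; split=> i.
  - by move: (h1 i); rewrite rowE -/(k i); lra.
  - by move: (h2 i); rewrite deltaE; lra.
  - by move: (h1 i); rewrite rowE -/(k i); lra.
  - by move: (h2 i); rewrite deltaE; lra.
split=> [[fx]|[w [/Forall_cat[/baseE fx csw]]]].
  (* [csP] is used with [s = t - x^T (M x + q0)], the room that [t] leaves for the inner maximum. *)
  rewrite addrC -lerBrDr => /csP[w [csw wt]].
  exists w; split; first by apply/Forall_cat; split=> //; apply/baseE.
  by rewrite objE addrC -lerBrDr.
rewrite objE => wt; split=> //; rewrite addrC -lerBrDr; apply/csP.
by exists w; split=> //; rewrite lerBrDr addrC.
Qed.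

Let K : 'M[R]_(L, n) := \matrix_(l, i) q l i 0.

Let KE x l : (K *m x) l 0 = dot x (q l).
Proof. by rewrite dotC dotE mxE; apply: eq_bigr => i _; rewrite mxE. Qed.

Let image_KE (U : set 'cV[R]_L) x :
  [set \sum_l u l 0 * dot x (q l) | u in U]
  = [set \sum_l u l 0 * (K *m x) l 0 | u in U].
Proof.
by apply: eq_imagel => u _; apply: eq_bigr => l _; rewrite KE.
Qed.

Lemma robust_lcp_ball1_tractable :
  psd M -> tractable_reformulation (robust_lcp M q0 q (@ball1 R L)).
Proof.
move=> psdM.
apply: (@robust_lcp_reformulation 1 _
  (* This first constraint says [0 <= w]; for [L = 0] nothing else bounds [w] from below. *)
  (AffineIneq (col_mx 0 (- delta_mx 0 0)) 0 ::
   (codom (fun l => AffineIneq (col_mx (q l) 0 - col_mx 0 (delta_mx 0 0)) 0)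
    ++ codom (fun l =>
         AffineIneq (- col_mx (q l) 0 - col_mx 0 (delta_mx 0 0)) 0)))) => // x s.
rewrite image_KE sup_ball1.
have wE (w : 'cV[R]_1) : dot (col_mx 0 (delta_mx 0 0)) (col_mx x w) = w 0 0.
  by rewrite dot_col_mx dot0l add0r dot_delta.
have NwE (w : 'cV[R]_1) :
    dot (col_mx 0 (- delta_mx 0 0)) (col_mx x w) = - w 0 0.
  by rewrite dot_col_mx dot0l add0r dotNl dot_delta.
have qE (w : 'cV[R]_1) l :
    dot (col_mx (q l) 0) (col_mx x w) = (K *m x) l 0.
  by rewrite dot_col_mx dot0l addr0 KE dotC.
split=> [/normoo_leP[s0 Ks]|[w [+ ws]]].
  exists (const_mx s); split; last by rewrite big_ord1 mxE.
  constructor; first by rewrite /= NwE mxE addr0 oppr_le0.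
  by apply/Forall_abs_le => l; rewrite wE qE [leRHS]mxE.
move=> cw; inversion cw as [|? ? w0 Kw]; subst; move: Kw => /Forall_abs_le Kw.
rewrite big_ord1 in ws; apply: le_trans ws; apply/normoo_leP.
move: w0; rewrite /= NwE addr0 oppr_le0; split=> // l.
by have := Kw l; rewrite wE qE.
Qed.

Lemma robust_lcp_ball2_tractable :
  psd M -> tractable_reformulation (robust_lcp M q0 q (@ball2 R L)).
Proof.
move=> psdM.
apply: (@robust_lcp_reformulation 1 _
  (* The cone constraint reads [norm2 (K *m x) <= w]. *)
  [:: SecondOrderCone (row_mx K 0) 0 (col_mx 0 (delta_mx 0 0)) 0]) => // x s.
rewrite image_KE sup_ball2.
have socE (w : 'cV[R]_1) : satisfies (col_mx x w)
    (SecondOrderCone (row_mx K 0) 0 (col_mx 0 (delta_mx 0 0)) 0)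
    = (norm2 (K *m x) <= w 0 0) :> Prop.
  rewrite /= mul_row_col mul0mx !addr0 dot_col_mx dot0l add0r.
  by rewrite dot_delta.
split=> [Ks|[w [cw]]].
  exists (const_mx s); split; last by rewrite big_ord1 mxE.
  by constructor => //; rewrite socE [leRHS]mxE.
by rewrite big_ord1; apply: le_trans; inversion cw; rewrite -socE.
Qed.

Lemma robust_lcp_balloo_tractable :
  psd M -> tractable_reformulation (robust_lcp M q0 q (@balloo R L)).
Proof.
move=> psdM.
apply: (@robust_lcp_reformulation L _
  (codom (fun l => AffineIneq (col_mx (q l) 0 - col_mx 0 (delta_mx l 0)) 0)
   ++ codom (fun l =>
        AffineIneq (- col_mx (q l) 0 - col_mx 0 (delta_mx l 0)) 0))) => // x s.
rewrite image_KE sup_balloo.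
have csE (w : 'cV[R]_L) l : `|dot (col_mx (q l) 0) (col_mx x w)|
      <= dot (col_mx 0 (delta_mx l 0)) (col_mx x w)
    = (`|(K *m x) l 0| <= w l 0).
  by rewrite !dot_col_mx !dot0l addr0 add0r dot_delta KE dotC.
split=> [Ks|[w [/Forall_abs_le Kw]]].
  (* With this witness every bound [|(K x)_l| <= w_l] is tight, so the sum of [w] is exactly the l_1
     norm. *)
  exists (\col_l `|(K *m x) l 0|); split.
    by apply/Forall_abs_le => l; rewrite csE [leRHS]mxE.
  by under eq_bigr do rewrite mxE.
by apply: le_trans; apply: ler_sum => l _; rewrite -csE.
Qed.

End Reformulation.

Theorem proposition3p2 (R : realType) (n L : nat) (M : 'M[R]_n)
    (hM : psd M) (q0 : 'cV[R]_n) (q : 'I_L -> 'cV[R]_n)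
    (U : set 'cV[R]_L)
    (hU : [\/ U = @ball1 R L, U = @ball2 R L | U = @balloo R L]) :
  tractable_reformulation (robust_lcp M q0 q U).
Proof.
case: hU => ->.
- exact: robust_lcp_ball1_tractable.
- exact: robust_lcp_ball2_tractable.
- exact: robust_lcp_balloo_tractable.
Qed.
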